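(* Let $\mathcal{T} = \langle \mathcal{S},\mathcal{A},p,r,\gamma,\beta,\pi_0\rangle$ be an entropy-regularized task with optimal action-value function $Q^*$, optimal state-value function $V^*$ and optimal policy $\pi^*$. Let $\Phi\colon\mathcal{S}\to\mathbb{R}$ be a bounded, but otherwise arbitrary, function. Consider the task $\mathcal{T}' = \langle \mathcal{S},\mathcal{A},p,r',\gamma,\beta,\pi_0\rangle$ with reward function $$r'(s,a,s') = r(s,a,s') + \gamma\Phi(s') - \Phi(s),$$ and denote by $\widetilde{Q}^*,\widetilde{V}^*,\widetilde{\pi}^*$ the optimal action-value function, optimal state-value function and optimal policy of $\mathcal{T}'$. Then $\widetilde{\pi}^*=\pi^*$, and for all $s\in\mathcal{S}$, $a\in\mathcal{A}$, $$\widetilde{Q}^*(s,a) = Q^*(s,a) - \Phi(s),\qquad \widetilde{V}^*(s) = V^*(s) - \Phi(s).$$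
   Context: An entropy-regularized task $\langle \mathcal{S},\mathcal{A},p,r,\gamma,\beta,\pi_0\rangle$ consists of discrete (finite or countable) state and action sets $\mathcal{S},\mathcal{A}$, transition dynamics $p(s'\mid s,a)$ (a probability distribution over $s'$ for each $(s,a)$), a bounded reward function $r\colon \mathcal{S}\times\mathcal{A}\times\mathcal{S}\to\mathbb{R}$, a discount factor $\gamma\in(0,1)$, an inverse temperature $\beta>0$, and a prior policy $\pi_0\colon\mathcal{S}\times\mathcal{A}\to(0,1)$ (for each $s$, $\pi_0(\cdot\mid s)$ is a probability distribution on $\mathcal{A}$). The optimal action-value function $Q^*$ of the task is the (unique) bounded solution of the soft Bellman optimality equation $$Q^*(s,a) = \mathbb{E}_{s'\sim p(\cdot\mid s,a)}\left[r(s,a,s') + \frac{\gamma}{\beta}\log \mathbb{E}_{a'\sim\pi_0(\cdot\mid s')} e^{\beta Q^*(s',a')}\right].$$ The optimal state-value function is $V^*(s)=\frac{1}{\beta}\log\sum_a\pi_0(a\mid s)e^{\beta Q^*(s,a)}$, and the optimal policy is $\pi^*(a\mid s)=\pi_0(a\mid s)e^{\beta Q^*(s,a)}/\sum_{a'}\pi_0(a'\mid s)e^{\beta Q^*(s,a')}$. *)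

(* Defs.v *)
From mathcomp Require Import all_boot all_order all_algebra.
From mathcomp Require Import all_classical all_reals all_analysis.

Set Implicit Arguments.
Unset Strict Implicit.
Unset Printing Implicit Defensive.
Import Order.TTheory GRing.Theory Num.Theory.
Import numFieldNormedType.Exports.

Local Open Scope classical_set_scope.
Local Open Scope ring_scope.

(* Unconditional sum of a real family; meaningful when the family is absolutely
   summable, in particular for [mu x * f x] with [mu] a probability mass
   function and [f] bounded.  [\esum] is a supremum of finite partial sums and
   is only meant for nonnegative families, hence the split. *)
Definition real_sum (R : realType) (T : choiceType) (f : T -> R) : R :=
  fine (\esum_(x in [set: T]) (f^\+ x)%:E) -
  fine (\esum_(x in [set: T]) (f^\- x)%:E).

Record pmass (R : realType) (T : countType) := Pmass {
  mass :> T -> R ;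
  mass_ge0 : forall x, 0 <= mass x ;
  mass_sum1 : \esum_(x in [set: T]) (mass x)%:E = 1%E
}.

Definition expect (R : realType) (T : countType) (mu : pmass R T)
    (f : T -> R) : R :=
  real_sum (fun x => mu x * f x).

(* A [countType] is a finite or countably infinite type. *)
Record task (R : realType) (S A : countType) := Task {
  trans : S -> A -> pmass R S ;
  reward : S -> A -> S -> R ;
  discount : R ;
  inv_temp : R ;
  prior : S -> pmass R A ;
  reward_bounded : bounded_fun (fun x : S * A * S => reward x.1.1 x.1.2 x.2) ;
  discount_itv : 0 < discount < 1 ;
  inv_temp_gt0 : 0 < inv_temp ;
  prior_itv : forall s a, 0 < prior s a < 1
}.

Section optimal.
Context (R : realType) (S A : countType) (T : task R S A).

Definition soft_bellman (Q : S -> A -> R) : Prop :=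
  forall s a,
    Q s a = expect (trans T s a) (fun s' =>
      reward T s a s' + discount T / inv_temp T *
        ln (expect (prior T s') (fun a' => expR (inv_temp T * Q s' a')))).

(* The bounded solution exists and is unique because the right-hand side of
   [soft_bellman] is a [discount T]-contraction for the sup norm, so [get]
   never returns its default value here. *)
Definition opt_Q : S -> A -> R :=
  get [set Q : S -> A -> R |
    bounded_fun (fun x : S * A => Q x.1 x.2) /\ soft_bellman Q].

Definition opt_V (s : S) : R :=
  (inv_temp T)^-1 *
    ln (real_sum (fun a => prior T s a * expR (inv_temp T * opt_Q s a))).

Definition opt_policy (s : S) (a : A) : R :=
  prior T s a * expR (inv_temp T * opt_Q s a) /
    real_sum (fun a' => prior T s a' * expR (inv_temp T * opt_Q s a')).

Definition shaped_reward (Phi : S -> R) (s : S) (a : A) (s' : S) : R :=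
  reward T s a s' + discount T * Phi s' - Phi s.

Lemma shaped_reward_bounded (Phi : S -> R) : bounded_fun Phi ->
  bounded_fun (fun x : S * A * S => shaped_reward Phi x.1.1 x.1.2 x.2).
Proof.
move=> [M [Mr bM]]; have [N [Nr bN]] := reward_bounded T.
pose M' := `|M| + 1; pose N' := `|N| + 1.
have hM s : `|Phi s| <= M' by apply: bM => //; rewrite ltr_pwDr// ler_norm.
have hN s a s' : `|reward T s a s'| <= N'.
  by apply: (bN N' _ (s, a, s')) => //; rewrite ltr_pwDr// ler_norm.
exists (N' + `|discount T| * M' + M'); split; first exact: num_real.
move=> x lx [[s a] s'] _ /=; apply: le_trans (ltW lx).
rewrite /shaped_reward (le_trans (ler_normB _ _))// lerD//.
rewrite (le_trans (ler_normD _ _))// lerD// normrM ler_wpM2l//.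
Qed.

Definition shaped_task (Phi : S -> R) (Phi_bounded : bounded_fun Phi) :
    task R S A :=
  {| trans := trans T ;
     reward := shaped_reward Phi ;
     discount := discount T ;
     inv_temp := inv_temp T ;
     prior := prior T ;
     reward_bounded := shaped_reward_bounded Phi_bounded ;
     discount_itv := discount_itv T ;
     inv_temp_gt0 := inv_temp_gt0 T ;
     prior_itv := @prior_itv _ _ _ T |}.

End optimal.

(* Main.v *)
Require Import Defs.
From mathcomp Require Import all_boot all_order all_algebra.
From mathcomp Require Import all_classical all_reals all_analysis.
From mathcomp Require Import ring lra.

(** The Bellman operator is monotone and maps [Q + c] to its value at [Q] plus
    [discount * c] (Blackwell's conditions).  Such an operator has exactly one
    bounded fixed point: existence follows from the Knaster-Tarski argument,
    uniqueness from the discounting.  The log-mean-exp [soft_value] commutes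
    with adding constants, so [Q - Phi] solves the shaped equation as soon as
    [Q] solves the original one, and uniqueness identifies the two optima. *)

Set Implicit Arguments.
Unset Strict Implicit.
Unset Printing Implicit Defensive.
Import Order.TTheory GRing.Theory Num.Theory.
Import numFieldNormedType.Exports.

Local Open Scope classical_set_scope.
Local Open Scope ring_scope.

(** * Bounded functions and unconditional real sums *)

Lemma bounded_funP (R : realType) (X : Type) (f : X -> R) :
  bounded_fun f <-> exists M, forall x, `|f x| <= M.
Proof.
split=> [[M [_ fM]]|[M fM]].
  by exists (`|M| + 1) => x; apply: fM => //; rewrite ltr_pwDr// ler_norm.
by exists M; split=> [|y My x _]; [exact: num_real|exact: le_trans (ltW My)].
Qed.

(** Bounding finite partial sums gives one inequality. The reverse one is the same bound for the
    factor [k^-1] and the family [k * f], which is why [k = 0] is treated apart. *)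
Lemma esumZl (R : realType) (X : choiceType) (k : R) (f : X -> R) :
  0 <= k -> (forall x, 0 <= f x) ->
  (\esum_(x in [set: X]) (k * f x)%:E = k%:E * \esum_(x in [set: X]) (f x)%:E)%E.
Proof.
have le_esumZ (c : R) (g : X -> R) : 0 <= c -> (forall x, 0 <= g x) ->
    (\esum_(x in [set: X]) (c * g x)%:E <=
     c%:E * \esum_(x in [set: X]) (g x)%:E)%E.
  move=> c0 g0; apply: ge_ereal_sup => _ [F [finF FX] <-].
  under eq_fsbigr do rewrite EFinM.
  rewrite -ge0_mule_fsumr; last by move=> x; rewrite lee_fin.
  rewrite lee_wpmul2l ?lee_fin//.
  by rewrite esum_ge//; exists F.
move=> k0 f0; have [->|kN0] := eqVneq k 0.
  by rewrite mul0e esum1// => x _; rewrite mul0r.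
have kV0 : 0 <= k^-1 by rewrite invr_ge0.
apply/eqP; rewrite eq_le le_esumZ//=.
have kf0 x : 0 <= k * f x by rewrite mulr_ge0.
have := le_esumZ _ _ kV0 kf0; under eq_esum do rewrite mulKf//.
move=> /(lee_wpmul2l (_ : (0 <= k%:E)%E)); rewrite lee_fin => /(_ k0).
by rewrite muleA -EFinM divff// mul1e.
Qed.

(** Frees [real_sum] from the positive and negative parts of its definition: any splitting into
    nonnegative summable families computes it. *)
Lemma real_sumB (R : realType) (X : choiceType) (f g : X -> R) :
  (forall x, 0 <= f x) -> (forall x, 0 <= g x) ->
  (\esum_(x in [set: X]) (f x)%:E < +oo)%E ->
  (\esum_(x in [set: X]) (g x)%:E < +oo)%E ->
  real_sum (fun x => f x - g x) =
  fine (\esum_(x in [set: X]) (f x)%:E) - fine (\esum_(x in [set: X]) (g x)%:E).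
Proof.
move=> f0 g0 foo goo.
have abs (h : X -> R) : (forall x, 0 <= h x) ->
    (\esum_(x in [set: X]) `|(h x)%:E| = \esum_(x in [set: X]) (h x)%:E)%E.
  by move=> h0; apply: eq_esum => x _; rewrite abse_EFin ger0_norm.
have sf : summable [set: X] (EFin \o f) by rewrite /summable abs.
have sg : summable [set: X] (EFin \o g) by rewrite /summable abs.
have /= := esumB sf sg (fun x _ => f0 x) (fun x _ => g0 x).
have fin (h : X -> \bar R) : (forall x, 0 <= h x)%E -> (\esum_(x in [set: X]) h x < +oo)%E ->
    (\esum_(x in [set: X]) h x \is a fin_num)%E.
  by move=> h0 hoo; rewrite ge0_fin_numE// esum_ge0.
pose d x := f x - g x.
have -> : (\esum_(x in [set: X]) (fun x => (f x)%:E - (g x)%:E)^\+ x =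
    \esum_(x in [set: X]) (d^\+ x)%:E)%E.
  by apply: eq_esum => x _; rewrite funeposE /funrpos -EFinB EFin_max.
have -> : (\esum_(x in [set: X]) (fun x => (f x)%:E - (g x)%:E)^\- x =
    \esum_(x in [set: X]) (d^\- x)%:E)%E.
  by apply: eq_esum => x _; rewrite funenegE /funrneg -EFinB -EFinN EFin_max.
(* The positive part of [f - g] is at most [f] and its negative part at most [g], so all four sums
   are finite and [fine] distributes over the differences. *)
have dp : (\esum_(x in [set: X]) (d^\+ x)%:E < +oo)%E.
  apply: le_lt_trans foo; apply: le_esum => x _.
  by rewrite lee_fin /funrpos /d ge_max f0 lerBlDr lerDl g0.
have dn : (\esum_(x in [set: X]) (d^\- x)%:E < +oo)%E.
  apply: le_lt_trans goo; apply: le_esum => x _.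
  by rewrite lee_fin /funrneg /d ge_max g0 opprB lerBlDr lerDl f0.
move=> /(congr1 fine); rewrite !fineB ?fin// => x; rewrite lee_fin.
- exact: funrpos_ge0.
- exact: funrneg_ge0.
Qed.

(** * Expectation of bounded functions *)

Section expect.
Context (R : realType) (X : countType) (mu : pmass R X).
Implicit Types (f g : X -> R) (k c : R).

Let mu0 x : 0 <= mu x := mass_ge0 mu x.

Lemma esum_pmassZ c : 0 <= c -> (\esum_(x in [set: X]) (mu x * c)%:E = c%:E)%E.
Proof.
move=> c0; under eq_esum do rewrite mulrC.
by rewrite esumZl// mass_sum1 mule1.
Qed.

Lemma esum_pmass_fin f M : (forall x, 0 <= f x <= M) ->
  (\esum_(x in [set: X]) (mu x * f x)%:E < +oo)%E.
Proof.
move=> fM.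
apply: (@le_lt_trans _ _ (\esum_(x in [set: X]) (mu x * `|M|)%:E)%E).
  apply: le_esum => x _; rewrite lee_fin ler_wpM2l//.
  by have /andP[_ fxM] := fM x; rewrite (le_trans fxM)// ler_norm.
by rewrite esum_pmassZ ?ltry.
Qed.

(* Shifting by [c] makes the integrand nonnegative, which turns [real_sum]
   into a single [\esum]. *)
Lemma expect_shift f c M : 0 <= c -> (forall x, 0 <= f x + c <= M) ->
  expect mu f = fine (\esum_(x in [set: X]) (mu x * (f x + c))%:E) - c.
Proof.
move=> c0 fcM.
have fc0 x : 0 <= mu x * (f x + c).
  by rewrite mulr_ge0//; case/andP: (fcM x).
have muc0 x : 0 <= mu x * c by rewrite mulr_ge0.
have := real_sumB fc0 muc0 (esum_pmass_fin fcM) _.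
rewrite esum_pmassZ// ltry => /(_ isT) <-.
by congr real_sum; apply/funext => x; rewrite mulrDr addrK.
Qed.

Lemma le_expect f g : bounded_fun f -> bounded_fun g ->
  (forall x, f x <= g x) -> expect mu f <= expect mu g.
Proof.
move=> /bounded_funP[M fM] /bounded_funP[N gN] fg.
(* One shift makes both integrands nonnegative, so the comparison reduces to that of two [\esum]. *)
pose c := `|M| + `|N|.
have c0 : 0 <= c by rewrite addr_ge0.
have Mc := ler_norm M; have Nc := ler_norm N.
have M0 := normr_ge0 M; have N0 := normr_ge0 N.
have fc x : 0 <= f x + c <= 2 * c.
  by have := fM x; rewrite ler_norml /c => /andP[? ?]; apply/andP; split; lra.
have gc x : 0 <= g x + c <= 2 * c.
  by have := gN x; rewrite ler_norml /c => /andP[? ?]; apply/andP; split; lra.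
rewrite (expect_shift c0 fc) (expect_shift c0 gc) lerB// fine_le//.
- rewrite ge0_fin_numE ?(esum_pmass_fin fc)// esum_ge0// => x _.
  by rewrite lee_fin mulr_ge0//; case/andP: (fc x).
- rewrite ge0_fin_numE ?(esum_pmass_fin gc)// esum_ge0// => x _.
  by rewrite lee_fin mulr_ge0//; case/andP: (gc x).
- by apply: le_esum => x _; rewrite lee_fin ler_wpM2l// lerD2r.
Qed.

Lemma expectDr f c : bounded_fun f ->
  expect mu (fun x => f x + c) = expect mu f + c.
Proof.
move=> /bounded_funP[M fM]; pose d := `|M| + `|c|.
have d0 : 0 <= d by rewrite addr_ge0.
have Mc := ler_norm M; have M0 := normr_ge0 M.
have /andP[cl cr] : - `|c| <= c <= `|c| by rewrite -ler_norml.
have fd x : 0 <= f x + d <= 2 * d.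
  by have := fM x; rewrite ler_norml /d => /andP[? ?]; apply/andP; split; lra.
(* Shifting [f] by [d] and [f + c] by [d - c] yields the same integrand, hence the same [\esum];
   only the subtracted shifts differ. *)
have dc0 : 0 <= d - c by rewrite /d; lra.
have fcd x : 0 <= f x + c + (d - c) <= 2 * d by rewrite addrACA subrr addr0.
rewrite (expect_shift d0 fd) (expect_shift dc0 fcd) opprB addrA addrAC.
congr (fine _ - _ + _); apply: eq_esum => x _.
by congr EFin; ring.
Qed.

Lemma expectZl f k : 0 <= k -> bounded_fun f ->
  expect mu (fun x => k * f x) = k * expect mu f.
Proof.
move=> k0 /bounded_funP[M fM].
have fM' x : 0 <= f x + `|M| <= 2 * `|M|.
  have := fM x; have := ler_norm M.
  by rewrite ler_norml => ? /andP[? ?]; apply/andP; split; lra.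
have kfM' x : 0 <= k * f x + k * `|M| <= k * (2 * `|M|).
  have /andP[? ?] := fM' x; rewrite -mulrDr.
  by rewrite mulr_ge0//= ler_wpM2l.
rewrite (expect_shift (normr_ge0 M) fM').
rewrite (expect_shift (mulr_ge0 k0 (normr_ge0 M)) kfM').
under eq_esum do rewrite -mulrDr mulrCA.
rewrite esumZl//.
  rewrite mulrBr fineM//.
  rewrite ge0_fin_numE ?(esum_pmass_fin fM')// esum_ge0// => x _.
  by rewrite lee_fin mulr_ge0//; case/andP: (fM' x).
by move=> x; rewrite mulr_ge0//; case/andP: (fM' x).
Qed.

(** Homogeneity with factor 0 gives the zero function expectation 0, and translation by [c] does the
    rest. *)
Lemma expect_cst c : expect mu (fun=> c) = c.
Proof.
have bf0 : bounded_fun (fun _ : X => 0 : R).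
  by apply/bounded_funP; exists 0 => x; rewrite normr0.
have : expect mu (fun=> 0 * 0) = 0 by rewrite expectZl// mul0r.
rewrite mul0r => E0; have := expectDr c bf0.
by rewrite add0r E0 add0r.
Qed.

Lemma expect_normr_le f M : (forall x, `|f x| <= M) -> `|expect mu f| <= M.
Proof.
move=> fM; have bf : bounded_fun f by apply/bounded_funP; exists M.
have bcst c : bounded_fun (fun _ : X => c : R).
  by apply/bounded_funP; exists `|c|.
(* Both endpoints become expectations of constants, so that monotonicity applies. *)
rewrite ler_norml -[X in X <= _ <= _]expect_cst -[X in _ <= _ <= X]expect_cst.
by apply/andP; split; apply: le_expect => // x; have := fM x;
  rewrite ler_norml => /andP[].
Qed.

End expect.

(** * The log-mean-exp and its monotonicity and translation laws *)

Section soft_value.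
Context (R : realType) (X : countType) (mu : pmass R X) (b : R).
Hypothesis b_gt0 : 0 < b.
Implicit Types q : X -> R.

Definition soft_value q : R :=
  b^-1 * ln (expect mu (fun x => expR (b * q x))).

Lemma bounded_fun_expR q : bounded_fun q ->
  bounded_fun (fun x => expR (b * q x)).
Proof.
move=> /bounded_funP[M qM]; apply/bounded_funP; exists (expR (b * M)) => x.
rewrite ger0_norm ?expR_ge0// ler_expR ler_pM2l//.
by have := qM x; rewrite ler_norml => /andP[].
Qed.

(** The integrand is bounded below by a positive constant. Positivity is what makes [ln] monotone
    and additive on these expectations. *)
Lemma expect_expR_gt0 q : bounded_fun q ->
  0 < expect mu (fun x => expR (b * q x)).
Proof.
move=> bq; have /bounded_funP[M qM] := bq.
apply: (lt_le_trans (expR_gt0 (b * - M))).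
rewrite -[leLHS](expect_cst mu); apply: le_expect.
- by apply/bounded_funP; exists `|expR (b * - M)|.
- exact: bounded_fun_expR.
- move=> x; rewrite ler_expR ler_pM2l//.
  by have := qM x; rewrite ler_norml => /andP[].
Qed.

Lemma expect_expRD q c : bounded_fun q ->
  expect mu (fun x => expR (b * (q x + c))) =
  expR (b * c) * expect mu (fun x => expR (b * q x)).
Proof.
move=> bq; rewrite -expectZl ?expR_ge0//; last exact: bounded_fun_expR.
by congr expect; apply/funext => x; rewrite mulrDr expRD mulrC.
Qed.

Lemma le_soft_value q1 q2 : bounded_fun q1 -> bounded_fun q2 ->
  (forall x, q1 x <= q2 x) -> soft_value q1 <= soft_value q2.
Proof.
move=> bq1 bq2 q12; rewrite ler_pM2l ?invr_gt0// ler_ln ?posrE.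
- by apply: le_expect => [||x]; [exact: bounded_fun_expR..|
    rewrite ler_expR ler_pM2l].
- exact: expect_expR_gt0.
- exact: expect_expR_gt0.
Qed.

Lemma soft_valueDr q c : bounded_fun q ->
  soft_value (fun x => q x + c) = soft_value q + c.
Proof.
move=> bq; rewrite /soft_value expect_expRD// lnM ?posrE ?expR_gt0//.
  by rewrite expRK mulrDr mulKf ?gt_eqF// addrC.
exact: expect_expR_gt0.
Qed.

Lemma soft_value_cst c : soft_value (fun=> c) = c.
Proof. by rewrite /soft_value expect_cst expRK mulKf ?gt_eqF. Qed.

Lemma soft_value_normr_le q M : (forall x, `|q x| <= M) -> `|soft_value q| <= M.
Proof.
move=> qM; have bq : bounded_fun q by apply/bounded_funP; exists M.
have bcst c : bounded_fun (fun _ : X => c : R).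
  by apply/bounded_funP; exists `|c|.
rewrite ler_norml -[X in X <= _ <= _]soft_value_cst.
rewrite -[X in _ <= _ <= X]soft_value_cst.
by apply/andP; split; apply: le_soft_value => // x; have := qM x;
  rewrite ler_norml => /andP[].
Qed.

End soft_value.

(** * Bounded fixed points of monotone discounting operators *)

Section blackwell.
Context (R : realType) (X : Type) (gamma : R) (B : (X -> R) -> X -> R).
Hypothesis gamma_itv : 0 < gamma < 1.
Hypothesis bounded_B : forall q : X -> R, bounded_fun q -> bounded_fun (B q).
Hypothesis le_B : forall q1 q2 : X -> R, bounded_fun q1 -> bounded_fun q2 ->
  (forall x, q1 x <= q2 x) -> forall x, B q1 x <= B q2 x.
Hypothesis B_Dr : forall (q : X -> R) c, bounded_fun q ->
  forall x, B (fun x => q x + c) x = B q x + gamma * c.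

(** With [d] the supremum of [q1 - q2], applying [B] to [q1 <= q2 + d] gives [q1 <= q2 + gamma * d].
    Hence [d <= gamma * d], which forces [d <= 0]. Used in both directions, this is uniqueness. *)
Lemma blackwell_le (q1 q2 : X -> R) : bounded_fun q1 -> bounded_fun q2 ->
  B q1 = q1 -> B q2 = q2 -> forall x, q1 x <= q2 x.
Proof.
have /andP[g0 g1] := gamma_itv.
move=> bq1 bq2 Bq1 Bq2 x.
have /bounded_funP[M1 q1M] := bq1; have /bounded_funP[M2 q2M] := bq2.
pose D := range (fun y => q1 y - q2 y); pose d := sup D.
have D0 : D !=set0 by exists (q1 x - q2 x); exists x.
have Dub : has_ubound D.
  exists (M1 + M2) => _ [y _ <-].
  have := q1M y; have := q2M y; rewrite !ler_norml.
  by move=> /andP[? ?] /andP[? ?]; lra.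
have le_d y : q1 y <= q2 y + d.
  by rewrite addrC -lerBlDr; apply: ub_le_sup => //; exists y.
have bq2d : bounded_fun (fun y => q2 y + d).
  apply/bounded_funP; exists (M2 + `|d|) => y.
  by rewrite (le_trans (ler_normD _ _))// lerD.
have : d <= gamma * d.
  apply: ge_sup => // _ [y _ <-]; have := le_B bq1 bq2d le_d y.
  by rewrite B_Dr// Bq1 Bq2 => ?; lra.
move=> dgd; have d_le0 : d <= 0 by nra.
by apply: (le_trans (le_d x)); rewrite gerDl.
Qed.

(** The fixed point is the pointwise supremum [m] of all [q] with [q <= B q] and values in
    [[- C, C]]. *)
Lemma blackwell_exists : exists2 q : X -> R, bounded_fun q & B q = q.
Proof.
have /andP[g0 g1] := gamma_itv.
have bcst c : bounded_fun (fun _ : X => c : R).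
  by apply/bounded_funP; exists `|c|.
have /bounded_funP[N BN] := bounded_B (bcst 0).
(* Chosen to solve [|N| + gamma * C = C], so that [B] sends the constant [- C] above itself and the
   constant [C] below itself. *)
pose C := `|N| / (1 - gamma).
have CE : `|N| + gamma * C = C.
  by rewrite /C; field; rewrite subr_eq0 gt_eqF.
have C0 : 0 <= C by rewrite divr_ge0// subr_ge0 ltW.
have Bcst c x : B (fun=> c) x = B (fun=> 0) x + gamma * c.
  by rewrite -B_Dr//; congr (B _ x); apply/funext => y; rewrite add0r.
have B0 x : - `|N| <= B (fun=> 0) x <= `|N|.
  by rewrite -ler_norml (le_trans (BN x))// ler_norm.
have BNC x : - C <= B (fun=> - C) x.
  by have /andP[? ?] := B0 x; rewrite Bcst; lra.
have BC x : B (fun=> C) x <= C.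
  by have /andP[? ?] := B0 x; rewrite Bcst; lra.
pose F := [set q : X -> R |
  (forall x, - C <= q x <= C) /\ forall x, q x <= B q x].
have FNC : F (fun=> - C).
  by split=> // x; rewrite lexx/=; lra.
have bF (q : X -> R) : (forall x, - C <= q x <= C) -> bounded_fun q.
  by move=> qC; apply/bounded_funP; exists C => x; rewrite ler_norml.
pose V x := [set q x | q in F]; pose m x := sup (V x).
have V0 x : V x !=set0 by exists (- C); exists (fun=> - C).
have Vub x : has_ubound (V x).
  by exists C => _ [q [qC _] <-]; case/andP: (qC x).
have le_m q x : F q -> q x <= m x.
  by move=> Fq; apply: ub_le_sup => //; exists q.
have mC x : - C <= m x <= C.
  rewrite (le_m (fun=> - C))//=; apply: ge_sup => // _ [q [qC _] <-].
  by case/andP: (qC x).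
have bm : bounded_fun m := bF _ mC.
(* Every [q] in [F] satisfies [q <= B q <= B m]; take the supremum over [q]. *)
have m_Bm x : m x <= B m x.
  apply: ge_sup => // _ [q Fq <-]; have [qC qB] := Fq.
  apply: (le_trans (qB x)); apply: le_B => // [|y]; first exact: bF.
  exact: le_m.
(* Monotonicity turns [m <= B m] into [B m <= B (B m)]. Membership of [B m] in [F] then gives the
   missing inequality [B m <= m]. *)
have FBm : F (B m).
  split=> x.
    apply/andP; split; first by rewrite (le_trans _ (m_Bm x))//; case/andP: (mC x).
    apply: (le_trans _ (BC x)); apply: le_B => // y.
    by case/andP: (mC y).
  by apply: le_B => //; exact: bounded_B.
by exists m => //; apply/funext => x; apply/le_anti; rewrite m_Bm le_m.
Qed.

End blackwell.

(** * The soft Bellman operator and its unique bounded fixed point *)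

Section bellman.
Context (R : realType) (S A : countType) (T : task R S A).

(** Uncurried, so that it is an operator on real functions of the single type [S * A], as the
    fixed-point lemmas require. *)
Definition bellman (q : S * A -> R) (x : S * A) : R :=
  expect (trans T x.1 x.2) (fun s' => reward T x.1 x.2 s' +
    discount T * soft_value (prior T s') (inv_temp T) (fun a => q (s', a))).

Let b0 : 0 < inv_temp T := inv_temp_gt0 T.

Let g_ge0 : 0 <= discount T.
Proof. by case/andP: (discount_itv T) => /ltW. Qed.

Lemma soft_bellmanP (Q : S -> A -> R) :
  soft_bellman T Q <-> bellman (fun x => Q x.1 x.2) = (fun x => Q x.1 x.2).
Proof.
have E s a : bellman (fun x => Q x.1 x.2) (s, a) =
    expect (trans T s a) (fun s' => reward T s a s' +
      discount T / inv_temp T *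
        ln (expect (prior T s') (fun a' => expR (inv_temp T * Q s' a')))).
  by congr expect; apply/funext => s'; rewrite /soft_value mulrA.
split=> [BQ|BQ s a]; first by apply/funext => -[s a]; rewrite E -BQ.
by rewrite -E BQ.
Qed.

Lemma bounded_fun_slice (q : S * A -> R) s :
  bounded_fun q -> bounded_fun (fun a => q (s, a)).
Proof. by move=> /bounded_funP[M qM]; apply/bounded_funP; exists M. Qed.

(** The bound is uniform in [s], [a] and [s']: it serves both for each integrand under [expect] and
    for the resulting function of [(s, a)]. *)
Lemma bounded_backup (q : S * A -> R) : bounded_fun q ->
  exists M, forall s a s', `|reward T s a s' + discount T *
    soft_value (prior T s') (inv_temp T) (fun a' => q (s', a'))| <= M.
Proof.
move=> /bounded_funP[M qM]; have /bounded_funP[N rN] := reward_bounded T.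
exists (N + discount T * M) => s a s'.
rewrite (le_trans (ler_normD _ _))// lerD//; first exact: (rN (s, a, s')).
by rewrite normrM ger0_norm// ler_wpM2l// soft_value_normr_le.
Qed.

Lemma bounded_bellman (q : S * A -> R) : bounded_fun q -> bounded_fun (bellman q).
Proof.
move=> /bounded_backup[M bM]; apply/bounded_funP; exists M => -[s a].
exact: expect_normr_le.
Qed.

Lemma le_bellman (q1 q2 : S * A -> R) : bounded_fun q1 -> bounded_fun q2 ->
  (forall x, q1 x <= q2 x) -> forall x, bellman q1 x <= bellman q2 x.
Proof.
move=> bq1 bq2 q12 [s a]; apply: le_expect.
- by have [M bM] := bounded_backup bq1; apply/bounded_funP; exists M.
- by have [M bM] := bounded_backup bq2; apply/bounded_funP; exists M.
- move=> s'; rewrite lerD2l ler_wpM2l//.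
  by apply: le_soft_value => //; exact: bounded_fun_slice.
Qed.

Lemma bellmanDr (q : S * A -> R) c : bounded_fun q ->
  forall x, bellman (fun x => q x + c) x = bellman q x + discount T * c.
Proof.
move=> bq [s a]; rewrite /bellman/= -expectDr; last first.
  by have [M bM] := bounded_backup bq; apply/bounded_funP; exists M.
congr expect; apply/funext => s'; rewrite soft_valueDr ?mulrDr ?addrA//.
exact: bounded_fun_slice.
Qed.

(** Existence of a bounded fixed point shows that [get] in [opt_Q] does not fall back on its default
    value. *)
Lemma opt_QP : bounded_fun (fun x : S * A => opt_Q T x.1 x.2) /\
  soft_bellman T (opt_Q T).
Proof.
apply: (@getPex _ [set Q : S -> A -> R |
  bounded_fun (fun x : S * A => Q x.1 x.2) /\ soft_bellman T Q]).
have [q bq Bq] := blackwell_exists (discount_itv T) bounded_bellman le_bellman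
  bellmanDr.
have qE : (fun x : S * A => q (x.1, x.2)) = q by apply/funext => -[].
exists (fun s a => q (s, a)); split; first by rewrite qE.
by apply/soft_bellmanP; rewrite qE.
Qed.

Lemma opt_Q_unique (Q : S -> A -> R) :
  bounded_fun (fun x : S * A => Q x.1 x.2) -> soft_bellman T Q -> Q = opt_Q T.
Proof.
move=> bQ /soft_bellmanP BQ; have [bO /soft_bellmanP BO] := opt_QP.
have le_fix := blackwell_le (discount_itv T) le_bellman bellmanDr.
apply/funext => s; apply/funext => a; apply/le_anti; apply/andP; split.
  exact: (le_fix _ _ bQ bO BQ BO (s, a)).
exact: (le_fix _ _ bO bQ BO BQ (s, a)).
Qed.

End bellman.

(** * Effect of potential-based shaping *)

Lemma soft_bellman_shaped (R : realType) (S A : countType) (T : task R S A)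
    (Phi : S -> R) (Phi_bounded : bounded_fun Phi) (Q : S -> A -> R) :
  bounded_fun (fun x : S * A => Q x.1 x.2) -> soft_bellman T Q ->
  soft_bellman (shaped_task T Phi_bounded) (fun s a => Q s a - Phi s).
Proof.
move=> bQ /soft_bellmanP BQ; apply/soft_bellmanP/funext => -[s a].
have := congr1 (fun q => q (s, a) - Phi s) BQ => /= <-.
rewrite /bellman/= -expectDr; last first.
  by have [M bM] := bounded_backup T bQ; apply/bounded_funP; exists M.
(* Here [- Phi s], constant in [s'], is already inside the expectation. The shift of the next soft
   value by [- Phi s'] is discounted and cancels the term [discount T * Phi s'] of the shaped
   reward. *)
congr expect; apply/funext => s'; rewrite /shaped_reward.
rewrite (soft_valueDr _ (inv_temp_gt0 T) (- Phi s'))//; first by ring.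
exact: (bounded_fun_slice s' bQ).
Qed.


Theorem theorem5 (R : realType) (S A : countType) (T : task R S A)
    (Phi : S -> R) (Phi_bounded : bounded_fun Phi) :
  let T' := shaped_task T Phi_bounded in
  [/\ opt_policy T' = opt_policy T,
      forall (s : S) (a : A), opt_Q T' s a = opt_Q T s a - Phi s &
      forall s : S, opt_V T' s = opt_V T s - Phi s].
Proof.
move=> T'; have [bQ BQ] := opt_QP T.
have QE s a : opt_Q T' s a = opt_Q T s a - Phi s.
  have bQPhi : bounded_fun (fun x : S * A => opt_Q T x.1 x.2 - Phi x.1).
    have /bounded_funP[M QM] := bQ; have /bounded_funP[N PhiN] := Phi_bounded.
    apply/bounded_funP; exists (M + N) => x.
    by rewrite (le_trans (ler_normB _ _))// lerD.
  by have /esym := opt_Q_unique bQPhi (soft_bellman_shaped Phi_bounded bQ BQ);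
    move=> /(congr1 (fun Q => Q s a)).
have bQs s : bounded_fun (opt_Q T s) := bounded_fun_slice s bQ.
have QsE s : opt_Q T' s = (fun a => opt_Q T s a - Phi s).
  exact/funext/QE.
split=> [|//|s]; last first.
  (* By conversion, [opt_V] is the [soft_value] of [opt_Q], and the shaped task has the prior and
     temperature of [T]. *)
  rewrite -[LHS]/(soft_value (prior T s) (inv_temp T) (opt_Q T' s)) QsE.
  exact: (soft_valueDr _ (inv_temp_gt0 T)).
pose policy (Q : A -> R) s a := prior T s a * expR (inv_temp T * Q a) /
  expect (prior T s) (fun a' => expR (inv_temp T * Q a')).
apply/funext => s; apply/funext => a.
rewrite -[LHS]/(policy (opt_Q T' s) s a) -[RHS]/(policy (opt_Q T s) s a) QsE.
(* The shift by [- Phi s] is constant in the action, so the same factor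
   [expR (inv_temp T * - Phi s)] appears in numerator and denominator and cancels. *)
rewrite /policy (expect_expRD _ (inv_temp_gt0 T) _ (bQs s)) mulrDr expRD.
have := expect_expR_gt0 (prior T s) (inv_temp_gt0 T) (bQs s).
move=> /lt0r_neq0 ?; field.
by apply/andP; split=> //; rewrite gt_eqF// expR_gt0.
Qed.
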